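(* Consider the saddle-point problem $\min_{x\in\mathcal X}\max_{y\in\mathcal Y}f(x,y)=\frac1M\sum_{m=1}^M f_m(x,y)$ under the smoothness, strong convexity-strong concavity, convexity-concavity and $\delta$-relatedness assumptions listed in the context, over a connected graph with a master node (owning $f_1$). Let $\{z^k\}$ be the sequence generated by the Star Min-Max Data Similarity Algorithm (described in the context) with stepsize $\gamma=\min\{\frac1{12\mu},\frac1{4\delta}\}$ and with each inner subproblem solved so that $\|u^k-\hat u^k\|^2\le\tilde e\,\|z^k-\hat u^k\|^2$, where $$\tilde e=\frac{1}{2\left(2+\frac{4\gamma\delta^2}{\mu}+\frac{4}{\gamma\mu}+4\gamma^2\delta^2\right)}.$$ Then, given $\varepsilon>0$, the number of communication rounds needed for $\|z^k-z^*\|^2\le\varepsilon$ is $\mathcal O\left(\left(1+\frac{\delta}{\mu}\right)\log\frac1\varepsilon\right)$.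
   Context: Problem and assumptions. $\mathcal X,\mathcal Y\subseteq\mathbb R^d$ are nonempty convex compact sets, $\mathcal Z=\mathcal X\times\mathcal Y$, $z=(x,y)$; $F_m(z)=(\nabla_x f_m(x,y),-\nabla_y f_m(x,y))$, $F=\frac1M\sum_{m=1}^M F_m$; $z^*=(x^*,y^* )\in\mathcal Z$ is the solution. Constants $L,\mu,\delta>0$. - Each $f_m:\mathbb R^{2d}\to\mathbb R$ is twice differentiable on an open set containing $\mathcal Z$ and $\|F_m(z_1)-F_m(z_2)\|\le L\|z_1-z_2\|$ for all $z_1,z_2\in\mathcal Z$. - $\langle F(z_1)-F(z_2),z_1-z_2\rangle\ge\mu\|z_1-z_2\|^2$ for all $z_1,z_2\in\mathcal Z$ ($f$ is $\mu$-strongly convex-strongly concave). - Each $f_m$ is convex-concave on $\mathcal Z$ (same inequality for $F_m$ with $0$ in place of $\mu$). - $\delta$-relatedness: for all $m$ and $(x,y)\in\mathcal Z$, $\|\nabla^2_{xx}f_m-\nabla^2_{xx}f\|\le\delta$, $\|\nabla^2_{xy}f_m-\nabla^2_{xy}f\|\le\delta$, $\|\nabla^2_{yy}f_m-\nabla^2_{yy}f\|\le\delta$ at $(x,y)$. Star Min-Max Data Similarity Algorithm (stepsize $\gamma$). Start at $z^0\in\mathcal Z$. For $k=0,1,2,\dots$: each worker $m$ computes $F_m(z^k)$ and sends it to the master; the master node (i) computes $v^k=z^k-\gamma(F(z^k)-F_1(z^k))$; (ii) finds $u^k$, an approximation (to the prescribed accuracy) of the solution $\hat u^k$ of $\min_{u_x\in\mathcal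 X}\max_{u_y\in\mathcal Y}\left[\gamma f_1(u_x,u_y)+\frac12\|u_x-v^k_x\|^2-\frac12\|u_y-v^k_y\|^2\right]$; (iii) sets $z^{k+1}=\mathrm{proj}_{\mathcal Z}\left[u^k+\gamma(F(z^k)-F_1(z^k)-F(u^k)+F_1(u^k))\right]$ and broadcasts $z^{k+1}$ to the workers. Here $\mathrm{proj}_{\mathcal Z}$ is Euclidean projection, and the number of communication rounds is of the order of the number of iterations $k$. The $\mathcal O(\log\frac1\varepsilon)$ hides an absolute constant and the dependence on $\|z^0-z^*\|^2$ inside the logarithm. *)

(* Defs.v *)
From mathcomp Require Import all_boot all_order all_algebra.
From mathcomp Require Import all_classical all_reals all_analysis.

Set Implicit Arguments.
Unset Strict Implicit.
Unset Printing Implicit Defensive.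

Import Order.TTheory GRing.Theory Num.Theory.
Import numFieldNormedType.Exports.

Local Open Scope classical_set_scope.
Local Open Scope ring_scope.

(* The library norm `|.| on row vectors and on pairs is the sup norm. It is used
   only through the topology (open, compact, differentiable); every norm in the
   problem data is the Euclidean norm, or the spectral norm it induces. *)
Section Euclidean.
Context {R : realType} {d : nat}.

Definition dot (u v : 'rV[R]_d) : R := \sum_(i < d) u ord0 i * v ord0 i.
Definition enorm (u : 'rV[R]_d) : R := Num.sqrt (dot u u).

Definition spectral_norm (A : 'M[R]_d) : R :=
  sup [set enorm (v *m A) | v in [set v : 'rV[R]_d | enorm v <= 1]].

End Euclidean.

Notation zspace R d := ('rV[R]_d * 'rV[R]_d)%type.

Section Problem.
Context {R : realType} {d : nat}.
Implicit Types (f : zspace R d -> R) (z : zspace R d).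
Implicit Types (X Y : set 'rV[R]_d).

Definition zdot (z w : zspace R d) : R := dot z.1 w.1 + dot z.2 w.2.
Definition znorm (z : zspace R d) : R := Num.sqrt (zdot z z).

Definition unit_x (i : 'I_d) : zspace R d := (delta_mx ord0 i, 0).
Definition unit_y (i : 'I_d) : zspace R d := (0, delta_mx ord0 i).

Definition grad_x f z : 'rV[R]_d := \row_i 'D_(unit_x i) f z.
Definition grad_y f z : 'rV[R]_d := \row_i 'D_(unit_y i) f z.

Definition hess_xx f z : 'M[R]_d :=
  \matrix_(i, j) 'D_(unit_x j) ('D_(unit_x i) f) z.
Definition hess_xy f z : 'M[R]_d :=
  \matrix_(i, j) 'D_(unit_y j) ('D_(unit_x i) f) z.
Definition hess_yy f z : 'M[R]_d :=
  \matrix_(i, j) 'D_(unit_y j) ('D_(unit_y i) f) z.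

Definition twice_differentiable_near (Z : set (zspace R d)) f : Prop :=
  exists U : set (zspace R d), [/\ open U, Z `<=` U &
    forall z, U z -> differentiable f z /\
      differentiable (fun w => (grad_x f w, grad_y f w)) z].

Definition saddle_op f z : zspace R d := (grad_x f z, - grad_y f z).

Definition lipschitz_op (Z : set (zspace R d)) (L : R)
    (G : zspace R d -> zspace R d) : Prop :=
  forall z1 z2, Z z1 -> Z z2 -> znorm (G z1 - G z2) <= L * znorm (z1 - z2).

Definition strongly_monotone (Z : set (zspace R d)) (mu : R)
    (G : zspace R d -> zspace R d) : Prop :=
  forall z1 z2, Z z1 -> Z z2 ->
    mu * znorm (z1 - z2) ^+ 2 <= zdot (G z1 - G z2) (z1 - z2).

Definition related (Z : set (zspace R d)) (delta : R) (g f : zspace R d -> R) :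
    Prop :=
  forall z, Z z ->
    [/\ spectral_norm (hess_xx g z - hess_xx f z) <= delta,
        spectral_norm (hess_xy g z - hess_xy f z) <= delta &
        spectral_norm (hess_yy g z - hess_yy f z) <= delta].

(* w solves min_{x in X} max_{y in Y} phi (x, y). *)
Definition saddle_point X Y (phi : zspace R d -> R) (w : zspace R d) : Prop :=
  (X `*` Y) w /\
  forall x y, X x -> Y y -> phi (w.1, y) <= phi w /\ phi w <= phi (x, w.2).

Definition is_proj (Z : set (zspace R d)) (w p : zspace R d) : Prop :=
  Z p /\ forall q, Z q -> znorm (p - w) <= znorm (q - w).

(* There are M.+1 workers; worker ord0 is the master, so f ord0 is f_1. *)
Section Algorithm.
Context {M : nat}.
Variable f : 'I_M.+1 -> zspace R d -> R.

Definition avg_fun z : R := M.+1%:R^-1 * \sum_(m < M.+1) f m z.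
Definition avg_op z : zspace R d :=
  M.+1%:R^-1 *: \sum_(m < M.+1) saddle_op (f m) z.
Definition master_op z : zspace R d := saddle_op (f ord0) z.

Definition inner_objective (gamma : R) (v u : zspace R d) : R :=
  gamma * f ord0 u + 2^-1 * enorm (u.1 - v.1) ^+ 2
                   - 2^-1 * enorm (u.2 - v.2) ^+ 2.

(* The iterates z k, with u k an inexact solution (relative squared accuracy e)
   of the k-th inner subproblem and uhat k its exact solution. The points u k are
   feasible, like the solutions they approximate: outside Z the operators are not
   controlled. *)
Definition star_run X Y (gamma e : R) (z u uhat : nat -> zspace R d) : Prop :=
  (X `*` Y) (z 0%N) /\
  forall k : nat,
    let v := z k - gamma *: (avg_op (z k) - master_op (z k)) in
    [/\ saddle_point X Y (inner_objective gamma v) (uhat k),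
        (X `*` Y) (u k),
        znorm (u k - uhat k) ^+ 2 <= e * znorm (z k - uhat k) ^+ 2 &
        is_proj (X `*` Y)
          (u k + gamma *: (avg_op (z k) - master_op (z k)
                           - avg_op (u k) + master_op (u k)))
          (z k.+1)].

End Algorithm.

Definition stepsize (mu delta : R) : R :=
  Num.min (12 * mu)^-1 (4 * delta)^-1.

Definition inner_accuracy (mu delta gamma : R) : R :=
  (2 * (2 + 4 * gamma * delta ^+ 2 / mu + 4 / (gamma * mu)
          + 4 * gamma ^+ 2 * delta ^+ 2))^-1.

End Problem.

Definition connected_graph (T : finType) (e : rel T) : Prop :=
  [/\ symmetric e, irreflexive e & forall i j, connect e i j].

(* rounds k is the number of communication rounds spent on the first k
   iterations; it is of the order of k, up to the constant factor c. *)
Definition order_of_iterations (c : nat) (rounds : nat -> nat) : Prop :=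
  forall k : nat, (rounds k <= c * k)%N /\ (k <= c * rounds k)%N.

(* Main.v *)
(* With F the averaged and F_1 the master operator, G = F - F_1 is
   2 delta-Lipschitz on Z: up to sign, G is the saddle operator of
   g = f_1 - f, so <G z1 - G z2, w> is a second directional derivative of g at
   an intermediate point (mean value theorem), which the three Hessian blocks
   control; the missing yx block is the transpose of the xy block by symmetry
   of second derivatives. The first-order conditions at uhat^k and z^*
   together with strong monotonicity give, for gamma delta <= 1/4,
     |uhat + gamma (G z - G uhat) - z^*|^2
       <= |z - z^*|^2 - (3/4) |uhat - z|^2 - 2 gamma mu |uhat - z^*|^2,
   and the negative |uhat - z|^2 term absorbs the inexactness of u^k. Each
   step thus contracts |z^k - z^*|^2 by 1 - gamma mu / 2, and
   1 / (gamma mu) <= 12 (1 + delta / mu). *)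
Require Import Defs.
From mathcomp Require Import all_boot all_order all_algebra.
From mathcomp Require Import all_classical all_reals all_analysis.
From mathcomp Require Import ring lra.

Import Order.TTheory GRing.Theory Num.Theory.
Import numFieldNormedType.Exports.

Local Open Scope classical_set_scope.
Local Open Scope ring_scope.

(** * Mean value theorem and symmetry of second derivatives *)

Section Calculus.
Context {R : realType} {V : normedModType R}.
Implicit Types (f : V -> R) (p v a b : V).

Lemma is_derive_line f p v (t : R) : derivable f (p + t *: v) v ->
  is_derive t (1 : R) (fun s : R => f (p + s *: v)) ('D_v f (p + t *: v)).
Proof.
have E : (fun h : R => h^-1 *: (((fun s : R => f (p + s *: v)) \o shift t) (h
  *: (1 : R))
            - f (p + t *: v))) =
  (fun h : R => h^-1 *: ((f \o shift (p + t *: v)) (h *: v) - f (p + t *: v))).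
  apply/funext => h /=; congr (_ *: (f _ - _)).
  by rewrite [_%:A]mulr1 scalerDl addrCA addrA.
by move=> fd; split; rewrite /derivable /derive E.
Qed.

Lemma mean_value f p v :
  (forall t : R, 0 <= t <= 1 -> derivable f (p + t *: v) v) ->
  exists2 t : R, 0 <= t <= 1 & f (p + v) - f p = 'D_v f (p + t *: v).
Proof.
move=> fd.
have dline (t : R) : t \in `[0, 1] ->
    is_derive t (1 : R) (fun s : R => f (p + s *: v)) ('D_v f (p + t *: v)).
  by rewrite in_itv => /fd; exact: is_derive_line.
have cont : {within `[0, 1], continuous (fun s : R => f (p + s *: v))}.
  by apply: derivable_within_continuous => t /dline[].
have dopen (t : R) : t \in `]0, 1[ ->
    is_derive t (1 : R) (fun s : R => f (p + s *: v)) ('D_v f (p + t *: v)).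
  by move=> t01; apply: dline; exact: subset_itv_oo_cc t01.
have [t] := @MVT_segment R (fun s : R => f (p + s *: v)) _ 0 1 ler01 dopen cont.
rewrite in_itv /= scale1r scale0r addr0 subr0 mulr1 => t01 ->.
by exists t.
Qed.

Lemma deriveZv f p (c : R) v : differentiable f p ->
  'D_(c *: v) f p = c * 'D_v f p.
Proof. by move=> fd; rewrite !deriveE // linearZ. Qed.

(** The mean value theorem along [t a], applied to [w => f (w + t b) - f w], turns the second
    difference into [t] times an increment of ['D_a f]. Expanding ['D_a f] to first order at [p] at
    both ends leaves the second derivative up to o(t^2). *)
Lemma second_difference f p a b (e : R) :
  (\forall w \near p, differentiable f w) -> differentiable ('D_a f) p ->
  0 < e ->
  exists2 r : R, 0 < r & forall t : R, 0 < t < r ->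
    `|f (p + t *: a + t *: b) - f (p + t *: a) - f (p + t *: b) + f p
      - t ^+ 2 * 'D_b ('D_a f) p| <= e * t ^+ 2.
Proof.
move=> fd ffd e0; set P := 'D_a f in ffd *.
(* [K] bounds [s a + c b] for [s], [c] in [0, 1]; the [+ 1] keeps it positive when [a] and [b]
   vanish. *)
set K := `|a| + `|b| + 1.
have K0 : 0 < K by rewrite /K ltr_wpDl // addr_ge0.
have /diff_locallyx PE := ffd.
(* Two remainders at tolerance [e / (2 K)], for arguments of norm at most [t K], multiplied by the
   outer [t], add up to [e t^2]. *)
have Po : \forall h \near (0 : V),
    `|P (h + p) - P p - 'd P p h| <= e / (2 * K) * `|h|.
  have e'0 : 0 < e / (2 * K) by rewrite divr_gt0 // mulr_gt0.
  have cancel (x y w : R) : x + y + w - x - y = w by ring.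
  near=> h; rewrite PE cancel.
  near: h; exact: (littleoP [littleo of 'o_0 id]).
have fd0 : \forall h \near (0 : V), differentiable f (h + p).
  by move: fd; rewrite (near_shift 0) subr0.
have [r /= r0 rP] := iffLR (@nbhs_ballP R V 0 _) (filterI Po fd0).
have small h : `|h| < r -> `|P (h + p) - P p - 'd P p h| <= e / (2 * K) * `|h|
     /\ differentiable f (h + p).
  by move=> hr; apply: rP; rewrite -ball_normE /= sub0r normrN.
exists (r / K); first exact: divr_gt0.
move=> t /andP[t0]; rewrite ltr_pdivlMr // => tr.
have hle (s c : R) : 0 <= s <= 1 -> 0 <= c <= 1 -> `|s *: (t *: a) + c *: (t *:
  b)| <= t * K.
  move=> /andP[s0 s1] /andP[c0 c1]; apply: (le_trans (ler_normD _ _)).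
  rewrite !normrZ (ger0_norm s0) (ger0_norm c0) (gtr0_norm t0) /K.
  have : s * (t * `|a|) <= t * `|a| by rewrite ler_piMl // mulr_ge0 // ltW.
  have : c * (t * `|b|) <= t * `|b| by rewrite ler_piMl // mulr_ge0 // ltW.
  by move: t0; rewrite !mulrDr mulr1; lra.
have smallh s c s01 c01 := small _ (le_lt_trans (hle s c s01 c01) tr).
have i0 : 0 <= (0 : R) <= 1 by rewrite lexx ler01.
have i1 : 0 <= (1 : R) <= 1 by rewrite lexx ler01.
have dsh w : differentiable f (w + t *: b) -> is_derive w (t *: a) (fun w => f
  (w + t *: b)) ('D_(t *: a) f (w + t *: b)).
  move=> fdw.
  have E : (fun h : R => h^-1 *: (((fun w => f (w + t *: b)) \o shift w) (h *:
    (t *: a))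
            - f (w + t *: b))) =
    (fun h : R => h^-1 *: ((f \o shift (w + t *: b)) (h *: (t *: a)) - f (w + t
      *: b))).
    by apply/funext => h /=; rewrite addrA.
  have := @diff_derivable _ _ _ f _ (t *: a) fdw.
  by split; rewrite /derivable /derive E.
have dd s : 0 <= s <= 1 -> is_derive (p + s *: (t *: a)) (t *: a)
     ((fun w => f (w + t *: b)) - f)
     (t * P (p + s *: (t *: a) + t *: b) - t * P (p + s *: (t *: a))).
  move=> s01.
  have [_] := smallh s 1 s01 i1; rewrite scale1r addrC addrA => d1.
  have [_] := smallh s 0 s01 i0; rewrite scale0r addr0 addrC => d2.
  rewrite /P -!deriveZv //; apply: is_deriveB; first exact: dsh.
  exact/derivableP/diff_derivable.
have [s s01] := mean_value _ p (t *: a) (fun s s01 => @ex_derive _ _ _ _ _ _ _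
  (dd s s01)).
have -> := @derive_val _ _ _ _ _ _ _ (dd s s01).
set h2 := p + s *: (t *: a).
rewrite (_ : _ - _ = f (p + t *: a + t *: b) - f (p + t *: a) - (f (p + t *: b)
  - f p)) //.
move=> E.
have [B1 _] := smallh s 1 s01 i1.
have [B2 _] := smallh s 0 s01 i0.
have H1 := hle s 1 s01 i1.
have H2 := hle s 0 s01 i0.
rewrite scale1r in B1 H1; rewrite scale0r addr0 in B2 H2.
have Eb : 'd P p (s *: (t *: a) + t *: b) = 'd P p (s *: (t *: a)) + t * 'D_b P
  p.
  by rewrite deriveE //; set w := s *: _; rewrite linearD; congr (_ + _);
    rewrite linearZ.
rewrite Eb [_ + p]addrC addrA -/h2 in B1; rewrite [_ + p]addrC -/h2 in B2.
move: B1 B2 E; set Q1 := P (h2 + _); set Q2 := P h2; set D := 'D_b P p;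
  set d1 := 'd P p _.
move=> B1 B2 E.
(* The common part [P p + d1] of the two expansions cancels, so only their remainders are left. *)
have -> : f (p + t *: a + t *: b) - f (p + t *: a) - f (p + t *: b) + f p -
      t ^+ 2 * D = t * (Q1 - P p - (d1 + t * D) - (Q2 - P p - d1)).
  by move: E; lra.
rewrite normrM (gtr0_norm t0) [e * _]mulrC expr2 -mulrA ler_pM2l //.
apply: (le_trans (ler_normB _ _)).
have -> : t * e = e / (2 * K) * (t * K) + e / (2 * K) * (t * K).
  by field; rewrite lt0r_neq0.
have ek : 0 <= e / (2 * K) by rewrite ltW // divr_gt0 // mulr_gt0.
apply: lerD; [apply: (le_trans B1)|apply: (le_trans B2)]; exact: ler_wpM2l.
Unshelve. all: by end_near. Qed.

(** The second difference is symmetric in [a] and [b], and both iterated derivatives approximate it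
    after division by [t^2]. *)
Lemma derive_sym f p a b :
  (\forall w \near p, differentiable f w) ->
  differentiable ('D_a f) p -> differentiable ('D_b f) p ->
  'D_b ('D_a f) p = 'D_a ('D_b f) p.
Proof.
move=> fd fa fb; apply/eqP; rewrite -subr_eq0 -normr_le0.
apply/ler_addgt0Pr => e e0.
have e20 : 0 < e / 2 by rewrite divr_gt0.
have [r r0 rP] := second_difference f p a b _ fd fa e20.
have [r' r'0 rP'] := second_difference f p b a _ fd fb e20.
pose t := Num.min r r' / 2.
have m0 : 0 < Num.min r r' by rewrite lt_min r0.
have t0 : 0 < t by rewrite divr_gt0.
have tm : t < Num.min r r' by rewrite ltr_pdivrMr // mulr_natr mulr2n ltrDl.
move: (tm); rewrite lt_min => /andP[tr tr'].
have := rP t; rewrite t0 tr => /(_ isT) B1.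
have := rP' t; rewrite t0 tr' => /(_ isT).
rewrite [p + t *: b + _]addrAC => B2.
have t20 : 0 < t ^+ 2 by rewrite exprn_gt0.
rewrite add0r -(ler_pM2l t20) -{1}(gtr0_norm t20) -normrM.
set S1 := _ + f p in B1; set S2 := _ + f p in B2.
have S12 : S2 = S1 by rewrite /S1 /S2 -!addrA; congr (_ + _); rewrite addrCA.
have split_diff (x y c S : R) : c * (x - y) = (S - c * y) - (S - c * x) by ring.
have -> : t ^+ 2 * ('D_b ('D_a f) p - 'D_a ('D_b f) p) =
    (S2 - t ^+ 2 * 'D_a ('D_b f) p) - (S1 - t ^+ 2 * 'D_b ('D_a f) p).
  by rewrite S12; exact: split_diff.
apply: (le_trans (ler_normB _ _)); apply: (le_trans (lerD B2 B1)).
by rewrite -mulrDl -splitr mulrC.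
Qed.

End Calculus.

(** * Euclidean and spectral norms *)

Section EuclideanGeometry.
Context {R : realType} {d : nat}.
Implicit Types (u v w : 'rV[R]_d) (z : zspace R d) (A : 'M[R]_d).

Lemma dotC u v : dot u v = dot v u.
Proof. by apply: eq_bigr => i _; rewrite mulrC. Qed.

Lemma dotDl u v w : dot (u + v) w = dot u w + dot v w.
Proof. by rewrite -big_split; apply: eq_bigr => i _; rewrite mxE mulrDl. Qed.

Lemma dotZl (c : R) u v : dot (c *: u) v = c * dot u v.
Proof. by rewrite /dot mulr_sumr; apply: eq_bigr => i _; rewrite mxE mulrA. Qed.

Lemma dotNl u v : dot (- u) v = - dot u v.
Proof. by rewrite -scaleN1r dotZl mulN1r. Qed.

Lemma dotDr u v w : dot w (u + v) = dot w u + dot w v.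
Proof. by rewrite !(dotC w) dotDl. Qed.

Lemma dotZr (c : R) u v : dot v (c *: u) = c * dot v u.
Proof. by rewrite !(dotC v) dotZl. Qed.

Lemma dot0l u : dot 0 u = 0.
Proof. by rewrite -(scale0r 0) dotZl mul0r. Qed.

Lemma dot0r u : dot u 0 = 0.
Proof. by rewrite dotC dot0l. Qed.

Lemma dot_ge0 u : 0 <= dot u u.
Proof. by apply: sumr_ge0 => i _; rewrite -expr2 sqr_ge0. Qed.

Lemma dot_eq0 u : dot u u = 0 -> u = 0.
Proof.
move=> /psumr_eq0P u0; apply/rowP => i; rewrite mxE; apply/eqP.
by rewrite -sqrf_eq0 expr2 u0 // => j _; rewrite -expr2 sqr_ge0.
Qed.

Lemma zdotC z z' : zdot z z' = zdot z' z.
Proof. by rewrite /zdot !(dotC z.1, dotC z.2). Qed.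

Lemma zdotDl z z' z'' : zdot (z + z') z'' = zdot z z'' + zdot z' z''.
Proof. by rewrite /zdot !dotDl addrACA. Qed.

Lemma zdotZl (c : R) z z' : zdot (c *: z) z' = c * zdot z z'.
Proof. by rewrite /zdot !dotZl mulrDr. Qed.

Lemma zdotNl z z' : zdot (- z) z' = - zdot z z'.
Proof. by rewrite -scaleN1r zdotZl mulN1r. Qed.

Lemma zdotDr z z' z'' : zdot z'' (z + z') = zdot z'' z + zdot z'' z'.
Proof. by rewrite !(zdotC z'') zdotDl. Qed.

Lemma zdotZr (c : R) z z' : zdot z' (c *: z) = c * zdot z' z.
Proof. by rewrite !(zdotC z') zdotZl. Qed.

Lemma zdotNr z z' : zdot z' (- z) = - zdot z' z.
Proof. by rewrite !(zdotC z') zdotNl. Qed.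

Lemma zdot_sqrD z z' :
  zdot (z + z') (z + z') = zdot z z + 2 * zdot z z' + zdot z' z'.
Proof. by rewrite !(zdotDl, zdotDr) (zdotC z' z); ring. Qed.

Lemma zdot_ge0 z : 0 <= zdot z z.
Proof. by rewrite addr_ge0 // dot_ge0. Qed.

Lemma znorm_ge0 z : 0 <= znorm z.
Proof. exact: sqrtr_ge0. Qed.

Lemma enorm_ge0 u : 0 <= enorm u.
Proof. exact: sqrtr_ge0. Qed.

Lemma znorm_sqr z : znorm z ^+ 2 = zdot z z.
Proof. by rewrite sqr_sqrtr // zdot_ge0. Qed.

Lemma enorm_sqr u : enorm u ^+ 2 = dot u u.
Proof. by rewrite sqr_sqrtr // dot_ge0. Qed.

(** Expand [|t z - z'|^2 >= 0] and divide by [t]. *)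
Lemma zdot_young z z' (t : R) : 0 < t ->
  2 * zdot z z' <= t * zdot z z + t^-1 * zdot z' z'.
Proof.
move=> t0; have := zdot_ge0 (t *: z - z').
rewrite !(zdotDl, zdotDr, zdotNl, zdotNr, zdotZl, zdotZr) (zdotC z' z).
set a := zdot z z; set b := zdot z z'; set c := zdot z' z' => abc.
have -> : t * a + t^-1 * c = t^-1 * (t ^+ 2 * a + c) by field;
  rewrite lt0r_neq0.
by rewrite ler_pdivlMl //; lra.
Qed.

Lemma enormE u : enorm u = znorm (u, 0).
Proof. by rewrite /enorm /znorm /zdot /= dot0l addr0. Qed.

Lemma zdot_le z z' : zdot z z' <= znorm z * znorm z'.
Proof.
have [|ab] := leP (zdot z z') 0; first by move/le_trans; apply;
  rewrite mulr_ge0 ?znorm_ge0.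
rewrite -ler_sqr ?nnegrE ?(ltW ab) ?mulr_ge0 ?znorm_ge0 // exprMn !znorm_sqr.
have [b0|b0] := eqVneq (zdot z' z') 0.
  move: b0; rewrite /zdot => /eqP; rewrite paddr_eq0 ?dot_ge0 //.
  move=> /andP[/eqP/dot_eq0 z1 /eqP/dot_eq0 z2].
  by move: ab; rewrite /zdot z1 z2 !dot0r addr0 ltxx.
have {}b0 : 0 < zdot z' z' by rewrite lt0r b0 zdot_ge0.
(* With the weight [|z'|^2 / <z, z'>] the second term of Young's inequality is exactly [<z, z'>],
   which gives Cauchy-Schwarz. *)
have := zdot_young z z' _ (divr_gt0 b0 ab).
rewrite invf_div; set a := zdot z z; set b := zdot z z';
  set c := zdot z' z' => H.
have {H} : b <= c / b * a.
  by move: H; rewrite (divfK (lt0r_neq0 b0)); lra.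
by rewrite mulrAC ler_pdivlMr // expr2 (mulrC c).
Qed.

Lemma dot_le u v : dot u v <= enorm u * enorm v.
Proof.
rewrite !enormE; apply: le_trans (zdot_le _ _).
by rewrite /zdot /= dot0l addr0.
Qed.

Lemma enormZ (c : R) u : enorm (c *: u) = `|c| * enorm u.
Proof. by rewrite /enorm dotZl dotZr mulrA -expr2 sqrtrM ?sqr_ge0 // sqrtr_sqr.
  Qed.

Lemma enormN u : enorm (- u) = enorm u.
Proof. by rewrite -scaleN1r enormZ normrN1 mul1r. Qed.

Lemma enorm_mulmx_le A v : enorm (v *m A) <= spectral_norm A * enorm v.
Proof.
(* [sup] dominates its set only once that set is known to be bounded above. The Frobenius norm is a
   bound, by Cauchy-Schwarz on each column of [A]. *)
have ub : has_ubound [set enorm (v *m A) | v in [set v : 'rV[R]_d | enorm v <=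
  1]].
  exists (Num.sqrt (\sum_j dot (col j A)^T (col j A)^T)) => _ [w /= w1 <-].
  apply: ler_wsqrtr; apply: ler_sum => j _.
  have -> : (w *m A) ord0 j = dot w (col j A)^T.
    by rewrite mxE; apply: eq_bigr => i _; rewrite !mxE.
  set c := (col j A)^T;
    rewrite -expr2 -enorm_sqr -(real_normK (num_real _)) ler_sqr ?nnegrE
    ?enorm_ge0 //.
  have w0 := enorm_ge0 w; have c0 := enorm_ge0 c.
  have B x : enorm x <= 1 -> dot x c <= enorm c.
    by move=> x1; apply: le_trans (dot_le _ _) _; exact: ler_piMl.
  by rewrite ler_norml lerNl -dotNl !B ?enormN.
have [v0|v0] := eqVneq (enorm v) 0.
  have -> : v = 0 by apply: dot_eq0; rewrite -enorm_sqr v0 expr0n.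
  by rewrite mul0mx -(scale0r 0) enormZ normr0 !mul0r mulr0.
have {}v0 : 0 < enorm v by rewrite lt0r v0 enorm_ge0.
rewrite -ler_pdivrMr // mulrC.
apply: ub_le_sup => //; exists ((enorm v)^-1 *: v) => /=; last first.
  by rewrite -scalemxAl enormZ ger0_norm // invr_ge0 enorm_ge0.
by rewrite enormZ ger0_norm ?invr_ge0 ?enorm_ge0 // mulVf // lt0r_neq0.
Qed.

Lemma spectral_norm_bilinear A v w (c : R) : spectral_norm A <= c ->
  dot (v *m A) w <= c * (enorm v * enorm w).
Proof.
move=> Ac; apply: (le_trans (dot_le _ _));
  rewrite mulrA ler_wpM2r ?enorm_ge0 //.
by apply: (le_trans (enorm_mulmx_le _ _)); rewrite ler_wpM2r ?enorm_ge0.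
Qed.

Lemma znormN z : znorm (- z) = znorm z.
Proof. by rewrite /znorm zdotNl zdotNr opprK. Qed.

(** The sum of two block norms is at most sqrt 2 times the norm of the pair. This is the source of
    the 2 in the Lipschitz constant [2 * delta]. *)
Lemma enormD_le_znorm z z' :
  (enorm z.1 + enorm z.2) * (enorm z'.1 + enorm z'.2) <= 2 * (znorm z * znorm
    z').
Proof.
have D (x : zspace R d) : (enorm x.1 + enorm x.2) ^+ 2 <= 2 * znorm x ^+ 2.
  rewrite znorm_sqr /zdot -!enorm_sqr; move: (enorm _) (enorm _) => a b.
  by have := sqr_ge0 (a - b); lra.
rewrite -ler_sqr ?nnegrE ?mulr_ge0 ?addr_ge0 ?enorm_ge0 ?znorm_ge0 //.
have -> : (2 * (znorm z * znorm z')) ^+ 2 = 2 * znorm z ^+ 2 * (2 * znorm z' ^+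
  2) by ring.
by rewrite exprMn ler_pM ?sqr_ge0.
Qed.

End EuclideanGeometry.

(** * First-order conditions and gradients *)

(** The first-order expansion of [g] at [p] is also one of [f]. This serves for formulas of
    directional derivatives that hold only near a point. *)
Lemma near_eq_differentiable (R : realType) (V W : normedModType R)
    (f g : V -> W) (p : V) :
  (\near p, f p = g p) -> differentiable g p -> differentiable f p.
Proof.
move=> fg gd; have fgp := nbhs_singleton fg.
have fE : f \o shift p = cst (f p) + 'd g p +o_ 0 id.
  apply/eqaddoP => _/posnumP[e].
  have /eqaddoP/(_ _ (gt0 e)) ge := diff_locally gd.
  have {}fg : \forall h \near (0 : V), f (h + p) = g (h + p).
    by move: fg; rewrite (near_shift 0) subr0.
  near=> h; have <- : (g \o shift p - (cst (g p) + 'd g p)) h =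
      (f \o shift p - (cst (f p) + 'd g p)) h.
    have E : f (h + p) = g (h + p) by near: h.
    by rewrite /= -[LHS]/(g (h + p) - (g p + 'd g p h)) -E -fgp.
  by near: h.
apply/diff_locallyP; rewrite (diff_unique (diff_continuous gd) fE); split => //.
exact: diff_continuous.
Unshelve. all: by end_near. Qed.

(** Divide by [t] and let [t] decrease to 0. The terms in [a] and [b] receive an explicitly expanded
    quadratic, such as a proximal term or a squared distance. *)
Lemma first_order_ge0 (R : realType) (V : normedModType R) (f : V -> R)
    (p v : V) (a b : R) :
  derivable f p v ->
  (forall t : R, 0 < t <= 1 -> 0 <= f (p + t *: v) - f p + t * a + t ^+ 2 * b)
    ->
  0 <= 'D_v f p + a.
Proof.
move=> fd fmin; rewrite -lerBlDr sub0r; apply/ler_addgt0Pr => e e0;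
  rewrite -lerBlDr.
rewrite /derive cvg_at_rightE //; apply: limr_ge.
  apply/cvg_ex; exists ('D_v f p) => A /fd /nbhs_ballP[_ /posnumP[r] rA].
  by exists r%:num => //= y ry /gt_eqF/negbT/rA; exact.
have b0 : 0 < `|b| + 1 by rewrite ltr_wpDl.
near=> t; have t0 : 0 < t by [].
have t1 : t <= 1 by near: t; exact: nbhs_right_le.
have tb : t <= e / (`|b| + 1) by near: t; apply: nbhs_right_le; exact: divr_gt0.
have := fmin t; rewrite t0 t1 => /(_ isT) H.
rewrite /= /GRing.scale /= ler_pdivlMl // (addrC _ p).
have {}tb : t * b <= e.
  move: tb; rewrite ler_pdivlMr // => tb; apply: le_trans tb.
  by rewrite ler_pM2l // (le_trans (ler_norm b)) // lerDl.
by have := ler_wpM2l (ltW t0) tb; lra.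
Unshelve. all: by end_near. Qed.

Lemma convex_set_segment (R : realType) (E : lmodType R) (X : set E) (x y : E)
    (t : R) :
  convex_set X -> X x -> X y -> 0 <= t <= 1 -> X (x + t *: (y - x)).
Proof.
move=> cX Xx Xy /andP[t0 t1].
have := cX y x (Itv01 t0 t1); rewrite !inE => /(_ Xy Xx).
rewrite /conv /= /unstable.onem scalerBl scale1r scalerBr.
by rewrite [x + (_ - _)]addrCA.
Qed.

Section Gradients.
Context {R : realType} {d : nat}.
Implicit Types (f g : zspace R d -> R) (z w a b h : zspace R d).

Lemma unit_decomposition w :
  w = \sum_i w.1 ord0 i *: unit_x i + \sum_i w.2 ord0 i *: unit_y i.
Proof.
case: w => x y /=.
have E1 : \sum_i x ord0 i *: unit_x i = (x, 0).
  rewrite [in RHS](row_sum_delta x); elim/big_rec2: _ => // i u v _ ->.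
  by rewrite /unit_x; congr (_, _); rewrite /= scaler0 addr0.
have E2 : \sum_i y ord0 i *: unit_y i = (0, y).
  rewrite [in RHS](row_sum_delta y); elim/big_rec2: _ => // i u v _ ->.
  by rewrite /unit_y; congr (_, _); rewrite /= scaler0 addr0.
by rewrite E1 E2; congr (_, _); rewrite /= ?addr0 ?add0r.
Qed.

Lemma derive_grad f z w : differentiable f z ->
  'D_w f z = zdot (grad_x f z, grad_y f z) w.
Proof.
move=> fd; rewrite deriveE // [in LHS](unit_decomposition w) linearD
  !linear_sum /=.
congr (_ + _); apply: eq_bigr => i _; rewrite linearZ mxE deriveE // mulrC //.
Qed.

(** The sign in the second block of the operator moves to the direction, so a product with
    [saddle_op f] becomes a directional derivative, to which the mean value theorem applies. *)
Lemma zdot_saddle_op f z w : differentiable f z ->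
  zdot (saddle_op f z) w = 'D_(w.1, - w.2) f z.
Proof.
by move=> fd; rewrite derive_grad //; congr (_ + _);
  rewrite dotNl dotC -dotNl dotC.
Qed.

End Gradients.

(** * Hessian blocks *)

Section SecondOrder.
Context {R : realType} {d : nat}.
Implicit Types (f g : zspace R d -> R) (z w a b h : zspace R d).

(** Phrased through directional derivatives, the form that [derive_sym] consumes and that passes to
    linear combinations. *)
Definition twice_differentiable_at f z :=
  (\forall w \near z, differentiable f w) /\
  forall a, differentiable ('D_a f) z.

Lemma differentiable_at f z : twice_differentiable_at f z -> differentiable f z.
Proof. by case=> /nbhs_singleton. Qed.

Lemma differentiable_zdot (F : zspace R d -> zspace R d) z a :
  differentiable F z -> differentiable (fun w => zdot (F w) a) z.
Proof.
move=> Fd.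
have d1 : differentiable (fun w => (F w).1) z.
  apply: (@differentiable_comp _ _ _ _ F fst z Fd).
  apply: (@linear_differentiable R (zspace R d) 'rV[R]_d (fst : {linear _ ->
    _})) => p.
  exact: cvg_fst.
have d2 : differentiable (fun w => (F w).2) z.
  apply: (@differentiable_comp _ _ _ _ F snd z Fd).
  apply: (@linear_differentiable R (zspace R d) 'rV[R]_d (snd : {linear _ ->
    _})) => p.
  exact: cvg_snd.
have dd (G : zspace R d -> 'rV[R]_d) u : differentiable G z ->
    differentiable (fun w => dot (G w) u) z.
  move=> Gd.
  rewrite (_ : (fun w => _) = \sum_i u ord0 i *: ((fun N : 'rV[R]_d => N ord0
    i) \o G)).
    apply: differentiable_sum => i; apply: differentiableZ.
    by apply: differentiable_comp => //; exact: differentiable_coord.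
  by apply/funext => w; rewrite fct_sumE; apply: eq_bigr => i _; rewrite mulrC.
by apply: differentiableD; exact: dd.
Qed.

(** Near [z], ['D_a f] is the product of the gradient with [a], hence inherits the differentiability
    of the gradient map. *)
Lemma twice_differentiable_near_at (Z : set (zspace R d)) f z :
  twice_differentiable_near Z f -> Z z -> twice_differentiable_at f z.
Proof.
move=> [U [oU ZU Ud]] /ZU Uz.
have fd : \forall w \near z, differentiable f w.
  near=> w; suff /Ud[] : U w by [].
  by near: w; exact: open_nbhs_nbhs.
split=> // a.
apply: (@near_eq_differentiable _ _ _ _ (fun w => zdot (grad_x f w, grad_y f w)
  a)).
  by near=> w; rewrite derive_grad //; near: w.
by apply: differentiable_zdot; case: (Ud _ Uz).
Unshelve. all: by end_near. Qed.

Lemma twice_differentiable_at_cst (c : R) z :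
  twice_differentiable_at (cst c) z.
Proof.
split=> [|a]; first by near=> w; exact: differentiable_cst.
rewrite (_ : 'D_a _ = cst 0); first exact: differentiable_cst.
by apply/funext => w; exact: derive_cst.
Unshelve. all: by end_near. Qed.

Lemma derive_combination (V : normedModType R) (f g : V -> R) (c : R) (z a : V)
  :
  derivable f z a -> derivable g z a ->
  'D_a (f + c *: g) z = 'D_a f z + c * 'D_a g z.
Proof.
by move=> fd gd; rewrite deriveD //; [rewrite deriveZ|exact: derivableZ].
Qed.

Section Combination.
Variables (f g : zspace R d -> R) (c : R) (z : zspace R d).
Hypotheses (fd : twice_differentiable_at f z) (gd : twice_differentiable_at g
  z).

Lemma near_derive_combination a :
  \forall w \near z, 'D_a (f + c *: g) w = ('D_a f + c *: 'D_a g) w.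
Proof.
have [[fd1 _] [gd1 _]] := (fd, gd).
near=> w.
have fw : derivable f w a by apply: diff_derivable; near: w.
have gw : derivable g w a by apply: diff_derivable; near: w.
exact: derive_combination.
Unshelve. all: by end_near. Qed.

Lemma twice_differentiable_at_combination : twice_differentiable_at (f + c *:
  g) z.
Proof.
have [[fd1 fd2] [gd1 gd2]] := (fd, gd); split=> [|a].
  by near=> w; apply: differentiableD; [|apply: differentiableZ]; near: w.
apply: near_eq_differentiable (near_derive_combination a) _.
by apply: differentiableD => //; exact: differentiableZ.
Unshelve. all: by end_near. Qed.

Lemma derive2_combination a b :
  'D_b ('D_a (f + c *: g)) z = 'D_b ('D_a f) z + c * 'D_b ('D_a g) z.
Proof.
have [[_ fd2] [_ gd2]] := (fd, gd).
rewrite (near_eq_derive _ (near_derive_combination a)).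
have df := @diff_derivable _ _ _ _ _ b (fd2 a).
have dg := @diff_derivable _ _ _ _ _ b (gd2 a).
exact: (derive_combination _ _ _ c _ _ df dg).
Qed.

End Combination.

(** Bilinear expansion along the coordinate directions; by [derive_sym] the yx block becomes the
    term where [h.1] meets [hess_xy] and [a.2]. *)
Lemma hessian_form g z a h : twice_differentiable_at g z ->
  'D_h ('D_a g) z =
    dot (a.1 *m hess_xx g z) h.1 + dot (a.1 *m hess_xy g z) h.2
    + (dot (h.1 *m hess_xy g z) a.2 + dot (a.2 *m hess_yy g z) h.2).
Proof.
move=> [gd1 gd2].
pose S a b := 'D_b ('D_a g) z.
have SC a' b' : S a' b' = S b' a' by exact: derive_sym.
have SE a' b' : S a' b' = \sum_j S a' (unit_x j) * b'.1 ord0 j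
                      + \sum_j S a' (unit_y j) * b'.2 ord0 j.
  rewrite {1}/S derive_grad //.
  by congr (_ + _); apply: eq_bigr => j _; rewrite mxE.
have xxE i j : S (unit_x i) (unit_x j) = hess_xx g z i j.
  rewrite [RHS]mxE; reflexivity.
have xyE i j : S (unit_x i) (unit_y j) = hess_xy g z i j.
  rewrite [RHS]mxE; reflexivity.
have yyE i j : S (unit_y i) (unit_y j) = hess_yy g z i j.
  rewrite [RHS]mxE; reflexivity.
rewrite -/(S a h) SE;
  move: S (hess_xx g z) (hess_xy g z) (hess_yy g z) SC SE xxE xyE yyE.
move=> S Hxx Hxy Hyy SC SE xxE xyE yyE.
have -> : \sum_j S a (unit_x j) * h.1 ord0 j =
    dot (a.1 *m Hxx) h.1 + dot (h.1 *m Hxy) a.2.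
  transitivity (\sum_j ((a.1 *m Hxx) ord0 j * h.1 ord0 j +
     (\sum_i Hxy j i * a.2 ord0 i) * h.1 ord0 j)).
    apply: eq_bigr => j _; rewrite SC SE mulrDl mxE; congr (_ * _ + _ * _).
      by apply: eq_bigr => i _; rewrite SC xxE mulrC.
    by apply: eq_bigr => i _; rewrite xyE.
  rewrite big_split /=; congr (_ + _).
  under eq_bigr do rewrite mulr_suml.
  rewrite exchange_big; apply: eq_bigr => i _; rewrite mxE mulr_suml.
  by apply: eq_bigr => j _; rewrite mulrAC (mulrC (Hxy _ _)).
have -> : \sum_j S a (unit_y j) * h.2 ord0 j =
    dot (a.1 *m Hxy) h.2 + dot (a.2 *m Hyy) h.2.
  rewrite -dotDl; apply: eq_bigr => j _; congr (_ * _).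
  rewrite SC SE !mxE; congr (_ + _); apply: eq_bigr => i _; rewrite SC.
    by rewrite xyE mulrC.
  by rewrite yyE mulrC.
by rewrite addrACA.
Qed.

(** The four block bounds factor as [delta (|a.1| + |a.2|) (|h.1| + |h.2|)]. *)
Lemma hessian_form_le g z a h (delta : R) : 0 <= delta ->
  twice_differentiable_at g z ->
  spectral_norm (hess_xx g z) <= delta ->
  spectral_norm (hess_xy g z) <= delta ->
  spectral_norm (hess_yy g z) <= delta ->
  'D_h ('D_a g) z <= 2 * delta * (znorm a * znorm h).
Proof.
move=> delta0.
have sum_le (p q r s n : R) : delta * ((p + q) * (r + s)) <= delta * (2 * n) ->
    delta * (p * r) + delta * (p * s) + (delta * (r * q) + delta * (q * s))
      <= 2 * delta * n by lra.
move=> gd gxx gxy gyy; rewrite hessian_form //.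
have xxB := spectral_norm_bilinear _ a.1 h.1 _ gxx.
have xyB := spectral_norm_bilinear _ a.1 h.2 _ gxy.
have yxB := spectral_norm_bilinear _ h.1 a.2 _ gxy.
have yyB := spectral_norm_bilinear _ a.2 h.2 _ gyy.
apply: (le_trans (lerD (lerD xxB xyB) (lerD yxB yyB))).
exact/sum_le/(ler_wpM2l delta0)/enormD_le_znorm.
Qed.

End SecondOrder.

(** * Saddle operators *)

Section SaddleOperators.
Context {R : realType} {d : nat}.
Implicit Types (f g : zspace R d -> R) (z w q : zspace R d).
Implicit Types (X Y : set 'rV[R]_d).

Lemma convex_setX_segment X Y z w (t : R) :
  convex_set X -> convex_set Y -> (X `*` Y) z -> (X `*` Y) w ->
  0 <= t <= 1 -> (X `*` Y) (z + t *: (w - z)).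
Proof. by move=> cX cY [Xz Yz] [Xw Yw] t01; split;
  exact: convex_set_segment. Qed.

(** The difference [w] of the two values is tested against itself: [|w|^2] is an increment of
    ['D_a g] with [a = (w.1, - w.2)]. Convexity keeps the intermediate point feasible, and one
    factor [|w|] is divided out. *)
Lemma saddle_op_lipschitz X Y g (delta : R) :
  convex_set X -> convex_set Y -> 0 <= delta ->
  (forall z, (X `*` Y) z -> twice_differentiable_at g z) ->
  (forall z, (X `*` Y) z -> [/\ spectral_norm (hess_xx g z) <= delta,
     spectral_norm (hess_xy g z) <= delta &
     spectral_norm (hess_yy g z) <= delta]) ->
  lipschitz_op (X `*` Y) (2 * delta) (saddle_op g).
Proof.
move=> cX cY delta0 gd gH z1 z2 Z1 Z2.
set w := saddle_op g z1 - saddle_op g z2; set h := z1 - z2.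
have [w0|w0] := eqVneq (znorm w) 0.
  by rewrite w0 !mulr_ge0 ?znorm_ge0.
have {}w0 : 0 < znorm w by rewrite lt0r w0 znorm_ge0.
rewrite -(ler_pM2r w0) -expr2 znorm_sqr {1}/w zdotDl zdotNl.
have g1 := differentiable_at _ _ (gd _ Z1);
  have g2 := differentiable_at _ _ (gd _ Z2).
rewrite !zdot_saddle_op //; set a := (w.1, - w.2).
have aw : znorm a = znorm w.
  by rewrite /znorm /zdot /= dotNl dotC dotNl opprK.
have seg (t : R) : 0 <= t <= 1 -> (X `*` Y) (z2 + t *: h).
  by move=> t01; exact: convex_setX_segment.
have [|t /seg Zt] := mean_value ('D_a g) z2 h.
  by move=> t /seg /gd[_ /(_ a)]; exact: diff_derivable.
have -> : z2 + h = z1 by rewrite /h addrC subrK.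
move=> ->.
have [xx xy yy] := gH _ Zt.
apply: (le_trans (hessian_form_le _ _ _ _ _ delta0 (gd _ Zt) xx xy yy)).
by rewrite aw (mulrC (znorm w)) mulrA.
Qed.

(** Each variable is moved alone along a feasible segment and the two first-order conditions are
    added. The case [c = 1/2] is the inner subproblem; [gamma = 1], [c = 0] is the original saddle
    problem. *)
Lemma saddle_point_variational X Y f (gamma c : R) (v w q : zspace R d) :
  convex_set X -> convex_set Y -> differentiable f w ->
  saddle_point X Y (fun u => gamma * f u + c * enorm (u.1 - v.1) ^+ 2
                             - c * enorm (u.2 - v.2) ^+ 2) w ->
  (X `*` Y) q ->
  0 <= zdot (gamma *: saddle_op f w + (2 * c) *: (w - v)) (q - w).
Proof.
have combine (g1 g2 d1 d2 : R) : 0 <= gamma * g1 + 2 * c * d1 ->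
    0 <= - gamma * g2 + 2 * c * d2 -> 0 <= gamma * (g1 - g2) + 2 * c * (d1 +
      d2).
  by lra.
move=> cX cY fd [[Xw Yw] sp] [Xq Yq].
have gfd (b : R) a : derivable (b *: f) w a.
  by apply: diff_derivable; exact: differentiableZ.
have scaleE (b : R) u : (b *: f) u = b * f u by [].
have sqD (x y : 'rV[R]_d) (t : R) :
    enorm (x + t *: y) ^+ 2 = enorm x ^+ 2 + t * (2 * dot x y) + t ^+ 2 * dot y
      y.
  by rewrite !enorm_sqr !(dotDl, dotDr, dotZl, dotZr) (dotC y x); ring.
have shift_sub (x y v' : 'rV[R]_d) (t : R) : x + t *: y - v' = (x - v') + t *:
  y.
  by rewrite addrAC.
have Dx : 0 <= 'D_(q.1 - w.1, 0) (gamma *: f) w + 2 * c * dot (w.1 - v.1) (q.1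
  - w.1).
  apply: (first_order_ge0 _ _ _ _ _ _ (c * dot (q.1 - w.1) (q.1 - w.1)) (gfd _
    _)) => t /andP[t0 t1].
  have := (sp _ _ (convex_set_segment _ _ _ _ _ t cX Xw Xq _) Yw).2.
  rewrite (ltW t0) t1 => /(_ isT) /=; rewrite shift_sub sqD.
  have -> : w + t *: (q.1 - w.1, 0) = (w.1 + t *: (q.1 - w.1), w.2).
    by case: (w) => w1 w2; congr (_, _); rewrite /= scaler0 addr0.
  rewrite !scaleE.
  move: (f _) (f w) (enorm _) (enorm _) (dot _ _) (dot _ _) => *; lra.
(* Maximality in [y] is minimality of the negated objective, hence the factor [- gamma]. *)
have Dy : 0 <= 'D_(0, q.2 - w.2) ((- gamma) *: f) w + 2 * c * dot (w.2 - v.2)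
  (q.2 - w.2).
  apply: (first_order_ge0 _ _ _ _ _ _ (c * dot (q.2 - w.2) (q.2 - w.2)) (gfd _
    _)) => t /andP[t0 t1].
  have := (sp _ _ Xw (convex_set_segment _ _ _ _ _ t cY Yw Yq _)).1.
  rewrite (ltW t0) t1 => /(_ isT) /=; rewrite shift_sub sqD.
  have -> : w + t *: (0, q.2 - w.2) = (w.1, w.2 + t *: (q.2 - w.2)).
    by case: (w) => w1 w2; congr (_, _); rewrite /= scaler0 addr0.
  rewrite !scaleE.
  move: (f _) (f w) (enorm _) (enorm _) (dot _ _) (dot _ _) => *; lra.
have gx : 'D_(q.1 - w.1, 0) f w = dot (grad_x f w) (q.1 - w.1).
  rewrite -[RHS]addr0 -(dot0r (grad_y f w)).
  exact: (derive_grad _ _ (q.1 - w.1, 0)).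
have gy : 'D_(0, q.2 - w.2) f w = dot (grad_y f w) (q.2 - w.2).
  rewrite -[RHS]add0r -(dot0r (grad_x f w)).
  exact: (derive_grad _ _ (0, q.2 - w.2)).
have sE : zdot (saddle_op f w) (q - w) =
    dot (grad_x f w) (q.1 - w.1) - dot (grad_y f w) (q.2 - w.2).
  by rewrite -dotNl.
have vE : zdot (w - v) (q - w) =
    dot (w.1 - v.1) (q.1 - w.1) + dot (w.2 - v.2) (q.2 - w.2) by [].
have fda a : derivable f w a by exact: diff_derivable.
move: Dx Dy; rewrite !deriveZ // gx gy zdotDl !zdotZl sE vE.
exact: combine.
Qed.

Lemma proj_nonexpansive X Y w p q :
  convex_set X -> convex_set Y -> is_proj (X `*` Y) w p -> (X `*` Y) q ->
  znorm (p - q) ^+ 2 <= znorm (w - q) ^+ 2.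
Proof.
move=> cX cY [Zp pmin] Zq.
(* With the zero function, [first_order_ge0] reduces to the obtuse-angle property of the
   projection. *)
have obtuse : 0 <= 'D_(q - p) (cst 0 : zspace R d -> R) p + 2 * zdot (p - w) (q
  - p).
  apply: (first_order_ge0 _ _ _ _ _ _ (zdot (q - p) (q - p)) (derivable_cst _ _
    _)) => t /andP[t0 t1].
  have := pmin _ (convex_setX_segment _ _ _ _ t cX cY Zp Zq _).
  rewrite (ltW t0) t1 => /(_ isT);
    rewrite -ler_sqr ?nnegrE ?znorm_ge0 // !znorm_sqr.
  have -> : p + t *: (q - p) - w = (p - w) + t *: (q - p) by rewrite addrAC.
  move: (p - w) (q - p) => a b.
  rewrite !(zdotDl, zdotDr, zdotZl, zdotZr) (zdotC b a) /=.
  move: (zdot a a) (zdot a b) (zdot b b) => *; lra.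
move: obtuse; rewrite derive_cst add0r.
have -> : w - q = (p - q) - (p - w) by rewrite opprB [RHS]addrC addrA subrK.
rewrite -(opprB p q) !znorm_sqr; move: (p - w) (p - q) => a b.
rewrite !(zdotDl, zdotDr, zdotNl, zdotNr) (zdotC b a).
have := zdot_ge0 a; move: (zdot a a) (zdot a b) (zdot b b) => *; lra.
Qed.

(** * The averaged function and its saddle operator *)

Section Average.
Variables (M : nat) (f : 'I_M.+1 -> zspace R d -> R) (z : zspace R d).
Hypothesis fd : forall m, twice_differentiable_at (f m) z.

(** The leading [0] gives the shape [f + c *: g] of the combination lemmas. *)
Lemma avg_funE : avg_fun f = 0 + M.+1%:R^-1 *: \sum_(m < M.+1) f m.
Proof. by apply/funext => w; rewrite add0r fct_sumE. Qed.

Lemma twice_differentiable_avg : twice_differentiable_at (avg_fun f) z.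
Proof.
have td0 : twice_differentiable_at (0 : zspace R d -> R) z.
  exact: twice_differentiable_at_cst.
rewrite avg_funE; apply: twice_differentiable_at_combination => //.
elim/big_ind: _ => // g1 g2 gd1 gd2; rewrite -[g2]scale1r.
exact: twice_differentiable_at_combination.
Qed.

Lemma derive_avg a :
  'D_a (avg_fun f) z = M.+1%:R^-1 * \sum_(m < M.+1) 'D_a (f m) z.
Proof.
have fa m : derivable (f m) z a by apply: diff_derivable;
  exact: differentiable_at.
by rewrite avg_funE add0r deriveZ ?derive_sum //; exact: derivable_sum.
Qed.

(** Links the operator used by the algorithm to the function whose Hessian enters [related] and
    whose saddle point is sought. *)
Lemma saddle_op_avg : saddle_op (avg_fun f) z = avg_op f z.
Proof.
have pairE (a b : 'I_M.+1 -> 'rV[R]_d) :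
    \sum_m (a m, b m) = (\sum_m a m, \sum_m b m).
  by elim/big_rec3: _ => // i x y p _ ->.
rewrite /saddle_op /avg_op pairE; congr (_, _); apply/rowP => i.
  rewrite !mxE derive_avg summxE; congr (_ * _).
  by apply: eq_bigr => m _; rewrite mxE.
rewrite !mxE derive_avg summxE -mulrN -sumrN; congr (_ * _).
by apply: eq_bigr => m _; rewrite !mxE.
Qed.

End Average.

End SaddleOperators.

(** * Convergence of the algorithm *)

Section Contraction.
Context {R : realType} {d : nat}.
Implicit Types (e q r g x Fh z u uhat zs : zspace R d).

(* With F the averaged and F1 the master operator, the vectors stand for
   e = uhat - z*, q = uhat - z, r = u - uhat, Fh = F uhat,
   g = (F - F1) z - (F - F1) uhat and x = (F - F1) uhat - (F - F1) u. *)
Lemma perturbed_contraction e q r g x Fh (gamma mu err : R) :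
  0 < gamma * mu <= 12^-1 -> 0 <= gamma ->
  err <= gamma * mu / (4 * (2 + gamma * mu)) ->
  0 <= zdot (q + gamma *: (Fh + g)) (- e) ->
  mu * zdot e e <= zdot Fh e ->
  gamma ^+ 2 * zdot g g <= zdot q q / 4 ->
  gamma ^+ 2 * zdot x x <= zdot r r / 4 ->
  zdot r r <= err * zdot q q ->
  zdot (e + r + gamma *: (g + x)) (e + r + gamma *: (g + x)) <=
    (1 - gamma * mu / 2) * zdot (e - q) (e - q).
Proof.
move=> /andP[a0 a1] gamma0 errle VI mono gg xx rr.
set a := gamma * mu in a0 a1 errle *.
set P := zdot (e + gamma *: g) (e + gamma *: g).
set N := zdot (r + gamma *: x) (r + gamma *: x).
have q0 := zdot_ge0 q; have P0 : 0 <= P := zdot_ge0 _.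
(* Since [|gamma x| <= |r| / 2], the factor is [(1 + 1/2)^2]. *)
have Nle : N <= 9 / 4 * zdot r r.
  have := zdot_young r (gamma *: x) 2^-1 _.
  rewrite invr_gt0 ltr0n => /(_ isT); rewrite /N invrK.
  rewrite !(zdotDl, zdotDr, zdotZl, zdotZr) (zdotC x r) !mulrA -expr2.
  by move: xx; set b := zdot r x; lra.
have {gg VI mono} Ple : P <= zdot (e - q) (e - q) - 3 / 4 * zdot q q - 2 * a *
  zdot e e.
  have amono : a * zdot e e <= gamma * zdot Fh e by rewrite -mulrA ler_wpM2l.
  move: VI; rewrite /P !(zdotDl, zdotDr, zdotZl, zdotZr, zdotNl, zdotNr) (zdotC
    e q) (zdotC e g).
  by move: gg amono; rewrite expr2 -mulrA; lra.
(* From [|e - q|^2 <= 2 |e|^2 + 2 |q|^2], trading the [|e|^2] term costs [2 a |q|^2], and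
   [3/4 - 2/12 = 7/12]. *)
have {Ple} Ple : P <= (1 - a) * zdot (e - q) (e - q) - 7 / 12 * zdot q q.
  have := zdot_ge0 (e + q) => /(ler_wpM2l (ltW a0)).
  have aq : a * zdot q q <= 12^-1 * zdot q q by rewrite ler_wpM2r.
  move: Ple; rewrite !(zdotDl, zdotDr, zdotNl, zdotNr) (zdotC e q) mulr0.
  lra.
(* The threshold on [err] is the one that cancels the factor [1 + 2 / a]. *)
have {errle rr Nle} Nle : (1 + 2 / a) * N <= 9 / 16 * zdot q q.
  have ca : 0 <= 1 + 2 / a by rewrite addr_ge0 // divr_ge0 // ltW.
  have rq : zdot r r <= a / (4 * (2 + a)) * zdot q q.
    by apply: le_trans rr _; rewrite ler_wpM2r.
  have {}Nle : N <= 9 / 4 * (a / (4 * (2 + a)) * zdot q q).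
    by apply: (le_trans Nle); rewrite ler_wpM2l.
  apply: (le_trans (ler_wpM2l ca Nle)).
  rewrite [leLHS](_ : _ = 9 / 16 * zdot q q) //.
  by field; rewrite !lt0r_neq0 // addr_gt0.
have -> : e + r + gamma *: (g + x) = (e + gamma *: g) + (r + gamma *: x).
  by rewrite scalerDr addrACA.
(* Young with weight [a / 2]: [(1 + a/2) (1 - a) <= 1 - a/2], and [9/16 < 7/12] makes the [|q|^2]
   terms nonpositive. *)
have a20 : 0 < a / 2 by rewrite divr_gt0.
have := zdot_young (e + gamma *: g) (r + gamma *: x) _ a20.
rewrite invf_div (zdot_sqrD (e + _)) -/P -/N.
have W0 := zdot_ge0 (e - q).
have := ler_wpM2l (ltW a20) Ple; have := mulr_ge0 (sqr_ge0 a) W0.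
have := mulr_ge0 (ltW a0) q0.
move: Nle Ple W0 q0 => /=.
move: (zdot (e - q) (e - q)) (zdot q q) (zdot (e + _) (r + _)) P N {P0} => W Q
  B P N.
lra.
Qed.

End Contraction.

(** Rewrites the optimality residual of the inner subproblem at [uhat] in the form
    [q + gamma (Fh + g)] of [perturbed_contraction]. *)
Lemma proximal_residual (R : nzRingType) (V : lmodType R) (c : R)
    (b g p h a : V) :
  c *: b + (p - (h - c *: a)) = (p - h) + c *: (g + (a - (g - b))).
Proof.
have -> : g + (a - (g - b)) = b + a by rewrite opprB addrCA (addrC g) subrK
  addrC.
by rewrite scalerDr opprB addrCA -[RHS]addrA; congr (_ + _);
  rewrite [RHS]addrC addrA.
Qed.

(** * Bounds on the stepsize and the inner accuracy *)

Section StepSize.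
Context {R : realType}.
Variables mu delta : R.
Hypotheses (mu0 : 0 < mu) (delta0 : 0 < delta).

Lemma stepsize_bounds :
  [/\ 0 < stepsize mu delta, stepsize mu delta * mu <= 12^-1,
      stepsize mu delta * delta <= 4^-1 &
      1 <= 12 * stepsize mu delta * (mu + delta)].
Proof.
have mu12 : 0 < 12 * mu by rewrite mulr_gt0.
have delta4 : 0 < 4 * delta by rewrite mulr_gt0.
rewrite /stepsize; split.
- by rewrite lt_min !invr_gt0 mu12.
- by rewrite -ler_pdivlMr // -invfM ge_min lexx.
- by rewrite -ler_pdivlMr // -invfM ge_min lexx orbT.
have [_|_] := leP (12 * mu)^-1 (4 * delta)^-1.
  have -> : 12 * (12 * mu)^-1 * (mu + delta) = 1 + delta / mu.
    by field; rewrite lt0r_neq0.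
  by rewrite lerDl divr_ge0 // ltW.
have -> : 12 * (4 * delta)^-1 * (mu + delta) = 3 + 3 * (mu / delta).
  by field; rewrite lt0r_neq0.
have := divr_ge0 (ltW mu0) (ltW delta0); lra.
Qed.

(** Dropping the two terms in [delta] from the denominator leaves exactly the right-hand side. *)
Lemma inner_accuracy_le (gamma : R) : 0 < gamma ->
  inner_accuracy mu delta gamma <= gamma * mu / (4 * (2 + gamma * mu)).
Proof.
move=> gamma0; have a0 : 0 < gamma * mu by rewrite mulr_gt0.
have -> : gamma * mu / (4 * (2 + gamma * mu)) = (2 * (2 + 4 / (gamma * mu)))^-1.
  field; rewrite !lt0r_neq0 // ?addr_gt0 ?mulr_gt0 //.
have t1 : 0 <= 4 * gamma * delta ^+ 2 / mu.
  by rewrite divr_ge0 ?mulr_ge0 ?exprn_ge0 // ltW.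
have t2 : 0 <= 4 * gamma ^+ 2 * delta ^+ 2 by rewrite mulr_ge0 ?sqr_ge0 //
  mulr_ge0 ?sqr_ge0.
have t3 : 0 < 4 / (gamma * mu) by rewrite divr_gt0.
rewrite /inner_accuracy lef_pV2 ?posrE ?mulr_gt0 //; [|lra|lra].
by rewrite ler_pM2l // ; lra.
Qed.

End StepSize.

(** * One-step contraction and geometric decay of the iterates *)

Section Algorithm.
Context {R : realType} {d M : nat}.
Variables (X Y : set 'rV[R]_d) (f : 'I_M.+1 -> zspace R d -> R) (mu delta : R).
Variables (zstar : zspace R d) (z u uhat : nat -> zspace R d).
Hypotheses (convX : convex_set X) (convY : convex_set Y).
Hypotheses (mu0 : 0 < mu) (delta0 : 0 < delta).
Hypothesis f_diff : forall m, twice_differentiable_near (X `*` Y) (f m).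
Hypothesis f_mono : strongly_monotone (X `*` Y) mu (avg_op f).
Hypothesis f_related : related (X `*` Y) delta (f ord0) (avg_fun f).
Hypothesis zstar_saddle : saddle_point X Y (avg_fun f) zstar.
Let gamma := stepsize mu delta.
Hypothesis run :
  star_run f X Y gamma (inner_accuracy mu delta gamma) z u uhat.

Let f_at w m : (X `*` Y) w -> twice_differentiable_at (f m) w.
Proof. exact: twice_differentiable_near_at. Qed.

Let avg_at w : (X `*` Y) w -> twice_differentiable_at (avg_fun f) w.
Proof. by move=> Zw; apply: twice_differentiable_avg => m; exact: f_at. Qed.

Lemma deviation_lipschitz :
  lipschitz_op (X `*` Y) (2 * delta) (fun w => avg_op f w - master_op f w).
Proof.
pose g := f ord0 + (-1) *: avg_fun f.
have g_at w : (X `*` Y) w -> twice_differentiable_at g w.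
  by move=> Zw; apply: twice_differentiable_at_combination;
    [exact: f_at|exact: avg_at].
have hessE w a b : (X `*` Y) w ->
    'D_b ('D_a g) w = 'D_b ('D_a (f ord0)) w - 'D_b ('D_a (avg_fun f)) w.
  move=> Zw; apply: etrans (derive2_combination _ _ _ _ (f_at _ ord0 Zw)
    (avg_at _ Zw) _ _) _.
  by rewrite mulN1r.
have gH w : (X `*` Y) w -> [/\ spectral_norm (hess_xx g w) <= delta,
    spectral_norm (hess_xy g w) <= delta & spectral_norm (hess_yy g w) <=
      delta].
  move=> Zw; have [xx xy yy] := f_related _ Zw.
  split.
  - apply: le_trans xx;
    rewrite (_ : hess_xx g w = hess_xx (f ord0) w - hess_xx (avg_fun f) w) //.
    by apply/matrixP => i j; rewrite !mxE hessE.
  - apply: le_trans xy;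
    rewrite (_ : hess_xy g w = hess_xy (f ord0) w - hess_xy (avg_fun f) w) //.
    by apply/matrixP => i j; rewrite !mxE hessE.
  apply: le_trans yy; rewrite (_ : hess_yy g w = hess_yy (f ord0) w - hess_yy
    (avg_fun f) w) //.
  by apply/matrixP => i j; rewrite !mxE hessE.
have gE w : (X `*` Y) w -> avg_op f w - master_op f w = - saddle_op g w.
  move=> Zw; rewrite -saddle_op_avg; last by move=> m; exact: f_at.
  have D a : 'D_a g w = 'D_a (f ord0) w - 'D_a (avg_fun f) w.
    apply: etrans (derive_combination _ _ _ _ _ _ _ _) _;
      last by rewrite mulN1r.
      by apply: diff_derivable; exact/differentiable_at/f_at.
    by apply: diff_derivable; exact/differentiable_at/avg_at.
  congr (_, _); apply/rowP => i; rewrite !mxE D; first by rewrite opprB.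
  by rewrite !opprK addrC.
move=> z1 z2 Z1 Z2; rewrite !gE // -opprD znormN.
exact: (saddle_op_lipschitz _ _ _ _ convX convY (ltW delta0)).
Qed.

Lemma star_contraction k :
  znorm (z k.+1 - zstar) ^+ 2 <=
    (1 - gamma * mu / 2) * znorm (z k - zstar) ^+ 2.
Proof.
have [gamma0 gmu gdelta _] := stepsize_bounds _ _ mu0 delta0;
  rewrite -/gamma in gamma0 gmu gdelta.
have Zz : (X `*` Y) (z k).
  by case: run => z0 step; case: k => // j; case: (step j) => _ _ _ [].
have [_ /(_ k)/= [uhat_saddle Zu acc proj]] := run.
have Zuhat := uhat_saddle.1; have Zs := zstar_saddle.1.
apply: (le_trans (proj_nonexpansive _ _ _ _ _ convX convY proj Zs)).
set F := avg_op f in proj *; set F1 := master_op f in proj *.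
pose e := uhat k - zstar; pose q := uhat k - z k; pose r := u k - uhat k.
pose g := (F (z k) - F1 (z k)) - (F (uhat k) - F1 (uhat k)).
pose x := (F (uhat k) - F1 (uhat k)) - (F (u k) - F1 (u k)).
have -> : u k + gamma *: (F (z k) - F1 (z k) - F (u k) + F1 (u k)) - zstar =
    e + r + gamma *: (g + x).
  rewrite /e /r /g /x [gamma *: (_ + (_ - (F (u k) - _)))](_ : _ = gamma *: (F
    (z k) - F1 (z k) - F (u k) + F1 (u k))).
    by rewrite addrAC; congr (_ + _); rewrite [RHS]addrC addrA subrK.
  by rewrite addrA subrK opprB; congr (_ *: _); rewrite addrA addrAC.
have -> : z k - zstar = e - q by rewrite /e /q opprB [RHS]addrC addrA subrK.
(* The Lipschitz constant times the stepsize is [2 gamma delta <= 1/2], squared to [1/4]. *)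
have lip2 (w1 w2 : zspace R d) : (X `*` Y) w1 -> (X `*` Y) w2 ->
    gamma ^+ 2 * zdot (F w1 - F1 w1 - (F w2 - F1 w2)) (F w1 - F1 w1 - (F w2 -
      F1 w2))
      <= zdot (w1 - w2) (w1 - w2) / 4.
  move=> Z1 Z2; have := deviation_lipschitz _ _ Z1 Z2.
  rewrite -/F -/F1; set D := _ - (_ - _).
  rewrite -!znorm_sqr => lip.
  have {}lip : gamma * znorm D <= 2^-1 * znorm (w1 - w2).
    apply: le_trans (ler_wpM2l (ltW gamma0) lip) _.
    by rewrite mulrA ler_wpM2r ?znorm_ge0 //; lra.
  move: lip; rewrite -ler_sqr ?nnegrE ?mulr_ge0 ?znorm_ge0 ?(ltW gamma0) //.
  by rewrite !exprMn; lra.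
rewrite !znorm_sqr.
apply: (perturbed_contraction _ _ _ _ _ (F (uhat k)) _ _ (inner_accuracy mu
  delta gamma)).
- by rewrite mulr_gt0.
- exact: ltW.
- exact: inner_accuracy_le.
- have := saddle_point_variational X Y (f ord0) gamma 2^-1 _ (uhat k) zstar
  convX convY _ uhat_saddle Zs.
  rewrite mulfV // scale1r => /(_ (differentiable_at _ _ (f_at _ ord0 Zuhat))).
  by rewrite (proximal_residual _ _ _ _ (F (uhat k))) (opprB (uhat k) zstar);
    exact.
- have mono := f_mono _ _ Zuhat Zs; rewrite znorm_sqr in mono.
  apply: (le_trans mono); rewrite -/F -/e zdotDl zdotNl gerBl.
  have := saddle_point_variational X Y (avg_fun f) 1 0 0 zstar (uhat k) convX
    convY
     (differentiable_at _ _ (avg_at _ Zs)) _ Zuhat.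
  rewrite mulr0 scale0r addr0 scale1r saddle_op_avg; last by move=> m;
    exact: f_at.
  apply; rewrite (_ : (fun _ => _) = avg_fun f) //.
  by apply/funext => w; rewrite mul1r !mul0r subr0 addr0.
- have -> : zdot q q = zdot (z k - uhat k) (z k - uhat k).
    by rewrite -(opprB (uhat k)) zdotNl zdotNr opprK.
  exact: lip2.
- have -> : zdot r r = zdot (uhat k - u k) (uhat k - u k).
    by rewrite -(opprB (u k)) zdotNl zdotNr opprK.
  exact: lip2.
have -> : zdot q q = zdot (z k - uhat k) (z k - uhat k).
  by rewrite -(opprB (uhat k)) zdotNl zdotNr opprK.
by rewrite -!znorm_sqr.
Qed.

(** Iterates the contraction with [1 - t <= exp (- t)], which yields a form ready for logarithms. *)
Lemma star_geometric k :
  znorm (z k - zstar) ^+ 2 <=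
    expR (- (gamma * mu / 2 * k%:R)) * znorm (z 0%N - zstar) ^+ 2.
Proof.
have [gamma0 gmu _ _] := stepsize_bounds _ _ mu0 delta0;
  rewrite -/gamma in gamma0 gmu.
elim: k => [|k IH]; first by rewrite mulr0 oppr0 expR0 mul1r.
apply: (le_trans (star_contraction k)).
have rate0 : 0 <= 1 - gamma * mu / 2 by lra.
apply: (le_trans (ler_wpM2l rate0 IH)).
rewrite mulrA ler_wpM2r ?sqr_ge0 // -(natr1 k) mulrDr mulr1 opprD expRD mulrC.
by rewrite ler_wpM2l ?expR_ge0 // expR_ge1Dx.
Qed.

End Algorithm.

Theorem theorem3 (R : realType) (c : nat) (c_gt0 : (0 < c)%N) :
  exists C : R, 0 < C /\
  forall (d M : nat) (edge : rel 'I_M.+1) (X Y : set 'rV[R]_d)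
    (f : 'I_M.+1 -> zspace R d -> R) (L mu delta : R)
    (zstar : zspace R d) (z u uhat : nat -> zspace R d) (rounds : nat -> nat),
  connected_graph edge ->
  X !=set0 -> convex_set X -> compact X ->
  Y !=set0 -> convex_set Y -> compact Y ->
  0 < L -> 0 < mu -> 0 < delta ->
  (forall m, twice_differentiable_near (X `*` Y) (f m)) ->
  (forall m, lipschitz_op (X `*` Y) L (saddle_op (f m))) ->
  strongly_monotone (X `*` Y) mu (avg_op f) ->
  (forall m, strongly_monotone (X `*` Y) 0 (saddle_op (f m))) ->
  (forall m, related (X `*` Y) delta (f m) (avg_fun f)) ->
  saddle_point X Y (avg_fun f) zstar ->
  star_run f X Y (stepsize mu delta)
    (inner_accuracy mu delta (stepsize mu delta)) z u uhat ->
  order_of_iterations c rounds ->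
  forall (eps : R) (k : nat), 0 < eps ->
    C * (1 + delta / mu) * ln (znorm (z 0%N - zstar) ^+ 2 / eps)
      <= (rounds k)%:R ->
    znorm (z k - zstar) ^+ 2 <= eps.
Proof.
have c0 : 0 < c%:R :> R by rewrite ltr0n.
(* [24 = 2 * 12]: 2 from the rate [gamma mu / 2], 12 from [stepsize_bounds]; [c] converts rounds
   into iterations. *)
exists (24 * c%:R); split; first by rewrite mulr_gt0.
move=> d M edge X Y f L mu delta zstar z u uhat rounds _ _ cX _ _ cY _ _ mu0 delta0.
move=> fd _ fmono _ frel sp run ord eps k eps0.
have geo := star_geometric _ _ _ _ _ _ _ _ _ cX cY mu0 delta0 fd fmono (frel ord0) sp run k.
have [gamma0 _ _ glow] := stepsize_bounds _ _ mu0 delta0.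
move: geo gamma0 glow; set gamma := stepsize _ _; set A := znorm (z 0%N - _) ^+ 2.
move=> geo gamma0 glow bound; apply: (le_trans geo).
(* A start at the solution is treated apart, since inverting [ln] needs a positive argument. *)
have [A0|A0] := eqVneq A 0; first by rewrite A0 mulr0 ltW.
have {}A0 : 0 < A by rewrite lt0r A0 sqr_ge0.
have kbound : 24 * (1 + delta / mu) * ln (A / eps) <= k%:R.
  have ck : (rounds k)%:R <= c%:R * k%:R :> R.
    by rewrite -natrM ler_nat; case: (ord k).
  by rewrite -(ler_pM2l c0) !mulrA (mulrC c%:R); apply: le_trans ck.
have Aeps : 0 < A / eps by rewrite divr_gt0.
have lnle : ln (A / eps) <= gamma * mu / 2 * k%:R.
  have a0 : 0 <= gamma * mu / 2 by rewrite divr_ge0 // mulr_ge0 // ltW.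
  (* A nonpositive logarithm means that the start is already within [eps]; multiplying by a factor
     at least 1 enlarges the logarithm only when it is nonnegative. *)
  have [ln0|ln0] := leP (ln (A / eps)) 0.
    by apply: le_trans ln0 _; rewrite mulr_ge0.
  apply: le_trans (ler_wpM2l a0 kbound).
  have -> : gamma * mu / 2 * (24 * (1 + delta / mu) * ln (A / eps)) =
      12 * gamma * (mu + delta) * ln (A / eps).
    by field; rewrite lt0r_neq0.
  by rewrite ler_peMl // ltW.
rewrite expRN mulrC ler_pdivrMr ?expR_gt0 // mulrC -ler_pdivrMr //.
by rewrite -(lnK Aeps) ler_expR.
Qed.
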